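(* Let $d \ge 1$ and let $f \in L^1(\mathbb{R}^d)$ be a density such that there exist $A \ge 1$ and a decreasing function $g:[A,\infty)\to(0,\infty)$ with $f(x) \asymp g(|x|)$ for $|x| \ge A$. Let $\theta \in \mathbb{S}^{d-1}$ and $\gamma \ge 0$ be such that both of the following hold: (i) $\displaystyle \lim_{t\to\infty}\frac{f(t\theta-y)}{f(t\theta)} = e^{\gamma(\theta\cdot y)}$ for every $y\in\mathbb{R}^d$; (ii) $\displaystyle h(\theta):=\int_{\mathbb{R}^d} e^{\gamma(\theta\cdot y)} f(y)\,dy<\infty$ and $\displaystyle \lim_{t\to\infty}\frac{f^{2\star}(t\theta)}{f(t\theta)} = 2h(\theta)$. Then $$\lim_{r\to\infty} K_f^A(r) = 0 .$$ In particular, if $f$ is an almost radial decreasing density satisfying (i) and (ii), then $\lim_{r\to\infty}K_f(r)=0$.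
   Context: A density is a non-negative, non-zero function $f\in L^1(\mathbb{R}^d)$ (with respect to Lebesgue measure; $f$ is a function defined pointwise). $\mathbb{S}^{d-1}$ is the unit sphere of $\mathbb{R}^d$. A function $g$ on an interval of $(0,\infty)$ is decreasing if $g(s)\ge g(t)$ whenever $s\le t$ (no strictness required). The notation $f(x)\asymp h(x)$, $x\in D$, means that there is a constant $c\ge1$ with $c^{-1}h(x)\le f(x)\le c\,h(x)$ for all $x\in D$. A density $f$ is almost radial decreasing if there is a decreasing function $g:(0,\infty)\to(0,\infty)$ with $f(x)\asymp g(|x|)$, $x\in\mathbb{R}^d\setminus\{0\}$. $f^{2\star}(x)=\int_{\mathbb{R}^d} f(x-y)f(y)\,dy$ is the pointwise-defined convolution of $f$ with itself. For $r \ge A$, $$K_f^A(r):=\sup_{|x|\ge A}\ \int_{\{y:\ |x-y|>r,\ |y|>r\}} \frac{f(x-y)f(y)}{f(x)}\,dy\in[0,\infty],$$ and $K_f(r):=\sup_{|x|\ge 1}\int_{\{y:\ |x-y|>r,\ |y|>r\}} \frac{f(x-y)f(y)}{f(x)}\,dy$. *)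

(* Defs.v *)
From HB Require Import structures.
From mathcomp Require Import all_boot all_order all_algebra.
From mathcomp Require Import all_classical all_reals all_analysis.
Set Implicit Arguments.
Unset Strict Implicit.
Unset Printing Implicit Defensive.
Import Order.TTheory GRing.Theory Num.Theory.
Import numFieldNormedType.Exports.
Local Open Scope classical_set_scope.
Local Open Scope ring_scope.

(* The space R^d, d >= 1, is 'rV[R]_d with d of the form n.+1.  The library
   norm on row vectors is the sup norm, so the Euclidean structure is defined
   here. *)

Definition dotv {R : realType} {d : nat} (x y : 'rV[R]_d) : R :=
  \sum_(i < d) x 0 i * y 0 i.

Definition enorm {R : realType} {d : nat} (x : 'rV[R]_d) : R :=
  Num.sqrt (dotv x x).

(* Lebesgue measure on R^d is the outer measure
     X |-> inf { sum_k vol(B_k) | X included in the union of the boxes B_k }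
   restricted to its Caratheodory measurable sets, i.e. to the Lebesgue
   (completed Borel) sigma-algebra. *)

Section lebesgue_measure_Rn.
Context (R : realType) (n : nat).
Local Notation V := 'rV[R]_n.+1.

Definition box (p : V * V) : set V :=
  [set x | forall i, p.1 0 i < x 0 i <= p.2 0 i].

Definition box_volume (p : V * V) : R :=
  \prod_(i < n.+1) Num.max 0 (p.2 0 i - p.1 0 i).

Definition box_cover (X : set V) : set (nat -> V * V) :=
  [set B | X `<=` \bigcup_k box (B k)].

Definition lebesgue_outer (X : set V) : \bar R :=
  ereal_inf [set (\sum_(0 <= k <oo) (box_volume (B k))%:E)%E
            | B in box_cover X].

Local Open Scope ereal_scope.

Let vol_ge0 p : 0 <= (box_volume p)%:E.
Proof. by rewrite lee_fin; apply: prodr_ge0 => i _; rewrite le_max lexx. Qed.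

Let vol00 : box_volume (0%R, 0%R) = 0%R.
Proof.
by rewrite /box_volume big_ord_recl /= !mxE subrr maxxx mul0r.
Qed.

Lemma lebesgue_outer_ge0 X : 0 <= lebesgue_outer X.
Proof.
by apply: le_ereal_inf_tmp => _ [B _ <-]; apply: nneseries_ge0 => k _ _.
Qed.

Lemma lebesgue_outer0 : lebesgue_outer set0 = 0.
Proof.
apply/eqP; rewrite eq_le lebesgue_outer_ge0 andbT.
apply: ereal_inf_lbound; exists (fun=> (0%R, 0%R)); first by [].
by rewrite eseries0// => k _ _; rewrite vol00.
Qed.

Lemma le_lebesgue_outer : {homo lebesgue_outer : A B / A `<=` B >-> A <= B}.
Proof.
move=> A B AB; apply/ereal_inf_le_tmp => x [C BC <-{x}].
by exists C => //; apply: subset_trans AB BC.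
Qed.

Lemma lebesgue_outer_sigma_subadditive : sigma_subadditive lebesgue_outer.
Proof.
move=> A; have [[i ioo]|] := pselect (exists i, lebesgue_outer (A i) = +oo).
  rewrite (eseries_pinfty _ _ ioo) ?leey// => k _.
  by rewrite -ltNye (lt_le_trans _ (lebesgue_outer_ge0 _)).
rewrite -forallNE => Aoo.
suff add2e (e : {posnum R}) : lebesgue_outer (\bigcup_n A n) <=
    \sum_(i <oo) lebesgue_outer (A i) + e%:num%:E.
  by apply/lee_addgt0Pr => _/posnumP[].
rewrite (le_trans _ (epsilon_trick _ _ _))//; last first.
  by move=> k; exact: lebesgue_outer_ge0.
pose P k (B : nat -> V * V) := box_cover (A k) B /\
  \sum_(j <oo) (box_volume (B j))%:E <=
  lebesgue_outer (A k) + (e%:num / (2 ^ k.+1)%:R)%:E.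
have [G PG] : {G : nat -> nat -> V * V & forall k, P k (G k)}.
  apply: (@choice _ _ P) => k; rewrite /P /lebesgue_outer.
  set S := (X in ereal_inf X); move infS : (ereal_inf S) => iS.
  case: iS infS => [r Sr|Soo|Soo].
  - have en1 : (0 < e%:num / (2 ^ k.+1)%:R)%R by [].
    have /(lb_ereal_inf_adherent en1) : ereal_inf S \is a fin_num by rewrite Sr.
    move=> [x [B AB xS] xlt].
    by exists B; split => //; rewrite xS -Sr; exact/ltW.
  - by have := Aoo k; rewrite /lebesgue_outer Soo.
  - by have := lebesgue_outer_ge0 (A k); rewrite /lebesgue_outer Soo.
pose vol2 := fun x : nat * nat => (box_volume (uncurry G x))%:E.
have vol2_ge0 x : 0 <= vol2 x by exact: vol_ge0.
apply: (@le_trans _ _ (\esum_(i in setT) vol2 i)).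
  apply: ereal_inf_lbound => /=.
  have /card_esym/ppcard_eqP[f] := card_nat2.
  exists (uncurry G \o f).
    move=> t [i _] /((PG i).1) [j _ Bijt].
    by exists (f^-1%FUN (i, j)) => //=; rewrite invK ?inE.
  rewrite -(esum_pred_image vol2 _ xpredT) ?[fun=> _]set_true//.
  by rewrite image_eq.
rewrite (_ : esum _ _ = \sum_(i <oo) \sum_(j <oo) (box_volume (G i j))%:E);
  last first.
  pose J : nat -> set (nat * nat) := fun i => [set (i, j) | j in setT].
  rewrite (_ : setT = \bigcup_k J k); last first.
    by rewrite predeqE => -[a b]; split => // _; exists a => //; exists b.
  rewrite esum_bigcupT /=; last 2 first.
    - apply/trivIsetP => i j _ _ ij.
      rewrite predeqE => -[x m] /=; split => //= -[] [_] _ [<-{x} _].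
      by move=> [m' _] [] /esym/eqP; rewrite (negbTE ij).
    - by move=> x; exact: vol2_ge0.
  rewrite -(image_id [set: nat]) -fun_true esum_pred_image//; last first.
    by move=> x _; exact: esum_ge0.
  apply: eq_eseriesr => /= j _.
  rewrite -(esum_pred_image vol2 (pair j) predT)//=; last first.
    by move=> ? ? _ _; exact: (@can_inj _ _ _ snd).
  by congr esum; rewrite predeqE => -[a b]; split; move=> [i _ <-]; exists i.
apply: lee_nneseries => [i _ _|i _]; first exact: nneseries_ge0.
exact: (PG i).2.
Qed.

HB.instance Definition _ := isOuterMeasure.Build R V lebesgue_outer
  lebesgue_outer0 lebesgue_outer_ge0 le_lebesgue_outer
  lebesgue_outer_sigma_subadditive.

Definition lebesgueRn : set (caratheodory_type lebesgue_outer) -> \bar R :=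
  lebesgue_outer.
HB.instance Definition _ := isMeasure.Build _ _ _ lebesgueRn
  (@caratheodory_measure0 _ _ lebesgue_outer)
  (@caratheodory_measure_ge0 _ _ lebesgue_outer)
  (@caratheodory_measure_sigma_additive _ _ lebesgue_outer).

End lebesgue_measure_Rn.
Arguments lebesgueRn {R n}.

Section densities.
Context (R : realType) (n : nat).
Implicit Types (f : 'rV[R]_n.+1 -> R) (g : R -> R).

Definition density f : Prop :=
  [/\ forall x, 0 <= f x, exists x, f x != 0 &
      lebesgueRn.-integrable [set: caratheodory_type (@lebesgue_outer R n)]
        (EFin \o f)].

(* f(x) is comparable to h(x) for x in D, written f(x) \asymp h(x). *)
Definition asymp (T : Type) (D : set T) (f h : T -> R) : Prop :=
  exists2 c : R, 1 <= c &
    forall x, D x -> c^-1 * h x <= f x /\ f x <= c * h x.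

(* g : I -> (0,oo) decreasing, not necessarily strictly; the values of g
   outside I are irrelevant. *)
Definition pos_decreasing (I : set R) g : Prop :=
  (forall s, I s -> 0 < g s) /\
  (forall s t, I s -> I t -> s <= t -> g t <= g s).

Definition almost_radial_decreasing f : Prop :=
  density f /\
  exists2 g : R -> R, pos_decreasing [set s | 0 < s] g &
    asymp [set x | x != 0] f (fun x => g (enorm x)).

Definition conv_integrand f (x y : 'rV[R]_n.+1) : R := f (x - y) * f y.

Local Open Scope ereal_scope.

Definition conv2 f (x : 'rV[R]_n.+1) : \bar R :=
  \int[lebesgueRn]_y (conv_integrand f x y)%:E.

(* This is the paper's h(theta). *)
Definition tilted_mass f (gamma : R) (theta : 'rV[R]_n.+1) : \bar R :=
  \int[lebesgueRn]_y (expR (gamma * dotv theta y) * f y)%:E.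

Definition Kfun f (A r : R) : \bar R :=
  ereal_sup [set \int[lebesgueRn]_(y in [set y : 'rV[R]_n.+1 |
                     (r < enorm (x - y)%R)%R /\ (r < enorm y)%R])
                   (conv_integrand f x y / f x)%:E
            | x in [set x : 'rV[R]_n.+1 | (A <= enorm x)%R]].

End densities.

(* Main.v *)
(* Split the integral of f(t theta - y) f(y) / f(t theta) over {|y| <= r},
   {|t theta - y| <= r} and the rest.  The first two pieces are exchanged by
   y -> t theta - y, and by Fatou and (i) their lower limit is at least the
   integral of e^(gamma theta.y) f(y) over {|y| <= r}; by (ii) the third piece
   is then at most twice the tail of h(theta) in the limit, which is small for
   large r.  Since f is comparable to g(|.|), the third piece taken at another x
   with |x| = t is comparable to the one at t theta.  Here Lebesgue measure only
   needs to be invariant under isometries up to a constant factor, which follows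
   by covering boxes with small cubes.  For bounded |x| the ratio f(x - y) / f(x)
   is bounded on {|x - y| > r}, and the integral is controlled by a tail of f. *)
Require Import Defs.
From HB Require Import structures.
From mathcomp Require Import all_boot all_order all_algebra.
From mathcomp Require Import all_classical all_reals all_analysis.
From mathcomp Require Import ring lra measurable_realfun.
Import Order.TTheory GRing.Theory Num.Theory.
Import numFieldNormedType.Exports.
Local Open Scope classical_set_scope.
Local Open Scope ring_scope.
Set Implicit Arguments.
Unset Strict Implicit.

(** * Outer measure of images: box covers, reflections, sets of small diameter *)

Section outer_measure_maps.
Context (R : realType) (n : nat).
Local Notation V := 'rV[R]_n.+1.
Local Notation outer := (@lebesgue_outer R n).

Lemma box_volume_ge0 (p : V * V) : 0 <= box_volume p.
Proof. by apply: prodr_ge0 => i _; rewrite le_max lexx. Qed.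

Lemma box_volume00 : box_volume (0 : V, 0 : V) = 0.
Proof. by rewrite /box_volume big_ord_recl /= !mxE subrr maxxx mul0r. Qed.

Lemma lebesgue_outer_box (p : V * V) : (outer (box p) <= (box_volume p)%:E)%E.
Proof.
apply: ereal_inf_lbound; exists (fun k => if k == 0%N then p else (0, 0)).
  by move=> x px; exists 0%N.
rewrite (@nneseries_split _ _ 0%N 1%N) => [|k _]; last first.
  by rewrite lee_fin box_volume_ge0.
rewrite add0n big_nat1 eseries0 ?adde0 //.
by move=> [|k] //= _ _; rewrite box_volume00.
Qed.

(** The images of the boxes of a cover of [X] cover the image of [X]; countable subadditivity sums
    the bounds, and the infimum over covers remains. *)
Lemma lebesgue_outer_image (phi : V -> V) (C : R) : 0 < C ->
  (forall p, (outer (phi @` box p) <= (C * box_volume p)%:E)%E) ->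
  forall X, (outer (phi @` X) <= C%:E * outer X)%E.
Proof.
move=> C0 phiC X; rewrite muleC -lee_pdivrMr //.
apply: le_ereal_inf_tmp => _ [B BX <-]; rewrite lee_pdivrMr // muleC.
have sub : phi @` X `<=` \bigcup_k (phi @` box (B k)).
  by move=> _ [x /BX [k _ xk] <-]; exists k => //; exists x.
apply: (le_trans (le_outer_measure outer _ _ sub)).
apply: (le_trans (outer_measure_sigma_subadditive outer _)).
rewrite -nneseriesZl; last by move=> k _; rewrite lee_fin box_volume_ge0.
by apply: lee_nneseries => k _; [move=> _; exact: lebesgue_outer_ge0|exact: phiC].
Qed.

(** The product is continuous in [s], so [s] may tend to 0 from the right. This removes the slack
    due to half-open boxes and to rounding up numbers of cubes. *)
Lemma lebesgue_outer_le_prod (X : set V) (C : R) (a : 'I_n.+1 -> R) :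
  (forall s, 0 < s -> (outer X <= (C * \prod_i (a i + s))%:E)%E) ->
  (outer X <= (C * \prod_i a i)%:E)%E.
Proof.
move=> H.
have c : C * \prod_i (a i + s) @[s --> 0^'+] --> C * \prod_i a i.
  apply: cvgM; first exact: cvg_cst.
  apply: (@cvg_big R^o _ _ _ _ (@mul_continuous R)) => i _.
  rewrite -[X in _ --> X]addr0; apply: cvgD; first exact: cvg_cst.
  by apply: cvg_at_right_filter; exact: cvg_id.
have := H 1 ltr01; have := lebesgue_outer_ge0 X.
case E : (outer X) => [x| |] // _ _.
rewrite lee_fin -(cvg_lim _ c) //; apply: limr_ge; first exact: (cvgP _ c).
near=> s; have /H : 0 < s by near: s; exact: nbhs_right_gt.
by rewrite E lee_fin.
Unshelve. all: by end_near. Qed.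

Lemma lebesgue_outer_box_enlarge (p q : V * V) (s : R) : 0 < s ->
  (forall i, q.2 0 i - q.1 0 i <= p.2 0 i - p.1 0 i + s) ->
  (outer (box q) <=
   (\prod_i (Num.max 0 (p.2 0 i - p.1 0 i) + s))%:E)%E.
Proof.
move=> s0 H; apply: le_trans (lebesgue_outer_box q) _; rewrite lee_fin.
apply: ler_prod => i _; rewrite le_max lexx /= ge_max.
have := H i; have : 0 <= Num.max 0 (p.2 0 i - p.1 0 i) by rewrite le_max lexx.
have : p.2 0 i - p.1 0 i <= Num.max 0 (p.2 0 i - p.1 0 i) by rewrite le_max lexx orbT.
by move=> *; apply/andP; split; lra.
Qed.

Lemma lebesgue_outer_reflect_le (v : V) (X : set V) :
  (outer ((fun y => (v - y)%R) @` X) <= outer X)%E.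
Proof.
rewrite -[leRHS]mul1e; apply: lebesgue_outer_image => // p.
apply: lebesgue_outer_le_prod => s s0; rewrite mul1r.
(* Boxes are open on the left and closed on the right, and the reflection exchanges the two;
   lowering the left corner by [s] takes in the closed face. *)
pose q : V * V := (v - p.2 - const_mx s, v - p.1).
apply: le_trans (@lebesgue_outer_box_enlarge p q _ s0 _).
  apply: le_outer_measure => _ [y py <-] i; have /andP[h1 h2] := py i.
  by rewrite !mxE; apply/andP; split; lra.
by move=> i; rewrite !mxE; lra.
Qed.

(** The reflection is an involution, so preimages are images and the one-sided bound applies in both
    directions. *)
Lemma lebesgue_outer_reflect (v : V) (X : set V) :
  outer ((fun y => v - y) @^-1` X) = outer X.
Proof.
have inv (Y : set V) : (fun y => v - y) @^-1` Y = (fun y => v - y) @` Y.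
  apply/seteqP; split => y /=.
    by move=> Yy; exists (v - y) => //; rewrite subKr.
  by move=> [z Yz <-]; rewrite subKr.
apply/eqP; rewrite eq_le {1}inv lebesgue_outer_reflect_le /=.
have {1}-> : X = (fun y => v - y) @` ((fun y => v - y) @^-1` X).
  by rewrite -inv; apply/seteqP; split => y /=; rewrite subKr.
exact: lebesgue_outer_reflect_le.
Qed.

Lemma lebesgue_outer_diam (X : set V) (L : R) : 0 < L ->
  (forall x y, X x -> X y -> forall i, `|x 0 i - y 0 i| <= L) ->
  (outer X <= ((3 * L) ^+ n.+1)%:E)%E.
Proof.
move=> L0 H; have [[x0 Xx0]|/set0P/negP/negPn/eqP->] := pselect (X !=set0);
  last by rewrite outer_measure0 lee_fin exprn_ge0 // mulr_ge0 // ltW.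
(* The left corner lies [2 * L] below [x0], not [L], since boxes omit their left faces; hence sides
   of length [3 * L]. *)
pose q : V * V := (x0 - const_mx (2 * L), x0 + const_mx L).
apply: (@le_trans _ _ (outer (box q))).
  apply: le_outer_measure => x Xx i; have := H x x0 Xx Xx0 i.
  by rewrite !mxE ler_norml => /andP[h1 h2]; apply/andP; split; lra.
apply: le_trans (lebesgue_outer_box q) _; rewrite lee_fin /box_volume.
rewrite (eq_bigr (fun=> 3 * L)) ?prodr_const ?card_ord // => i _.
rewrite !mxE (_ : _ - _ = 3 * L); last by ring.
by apply/max_idPr; rewrite mulr_ge0 // ltW.
Qed.

Lemma lebesgue_outer_bigsetU (J : finType) (P : pred J) (Q : J -> set V) :
  (outer (\big[setU/set0]_(j | P j) Q j) <= \sum_(j | P j) outer (Q j))%E.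
Proof.
apply: (big_ind2 (fun A b => (outer A <= b)%E)) => //.
  by rewrite outer_measure0.
move=> A a B b Aa Bb; apply: le_trans (outer_measureU2 _ _ _) _.
exact: leeD.
Qed.

End outer_measure_maps.

(** * Euclidean norm bounds and outer measure under nonexpansive maps *)

Section isometries.
Context (R : realType) (n : nat).
Local Notation V := 'rV[R]_n.+1.
Local Notation outer := (@lebesgue_outer R n).

Lemma dotv_ge0 (x : V) : 0 <= dotv x x.
Proof. by apply: sumr_ge0 => i _; rewrite -expr2 sqr_ge0. Qed.

Lemma sqr_enorm (x : V) : enorm x ^+ 2 = dotv x x.
Proof. by rewrite sqr_sqrtr // dotv_ge0. Qed.

Lemma enorm_ge0 (x : V) : 0 <= enorm x.
Proof. exact: sqrtr_ge0. Qed.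

Lemma abs_coord_le_enorm (x : V) i : `|x 0 i| <= enorm x.
Proof.
rewrite -sqrtr_sqr ler_wsqrtr // /dotv (bigD1 i) //= -expr2 lerDl.
by apply: sumr_ge0 => j _; rewrite -expr2 sqr_ge0.
Qed.

Lemma enorm_le (x : V) (L : R) : 0 <= L -> (forall i, `|x 0 i| <= L) ->
  enorm x <= n.+1%:R * L.
Proof.
move=> L0 H; rewrite -(@ler_pXn2r _ 2%N) ?nnegrE ?enorm_ge0 ?mulr_ge0 //.
rewrite sqr_enorm exprMn.
apply: (@le_trans _ _ (n.+1%:R * L ^+ 2)).
  rewrite mulr_natl -[X in _ *+ X](card_ord n.+1) -sumr_const.
  apply: ler_sum => i _; rewrite -expr2 -real_normK ?num_real //.
  by rewrite lerXn2r ?nnegrE.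
by rewrite ler_wpM2r ?sqr_ge0 // expr2 -natrM ler_nat leq_pmulr.
Qed.

(** The bound [K] is kept apart from [k] so that sums of different lengths share one index type when
    their product is expanded. *)
Lemma sum_ord_lt (K k : nat) (s : R) : (k <= K)%N ->
  \sum_(j < K | (j < k)%N) s = k%:R * s.
Proof.
by move=> kK; rewrite -(big_ord_widen _ (fun=> s) kK) sumr_const card_ord mulr_natl.
Qed.

(* Splitting a box into cubes of side [s] costs at most a factor
   [\prod_i (a_i + s) / \prod_i a_i] of volume, and the image of such a cube
   lies in a cube of side [n.+1 * 2s]; then let [s] tend to 0. *)
Lemma lebesgue_outer_nonexpansive_box (phi : V -> V) (p : V * V) :
  (forall x y, enorm (phi x - phi y) <= enorm (x - y)) ->
  (outer (phi @` box p) <=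
   ((3 * (n.+1%:R * 2)) ^+ n.+1 * box_volume p)%:E)%E.
Proof.
move=> phi1; apply: lebesgue_outer_le_prod => s s0.
pose a i := Num.max 0 (p.2 0 i - p.1 0 i).
have a0 i : 0 <= a i by rewrite /a le_max lexx.
pose k i := (Num.truncn (a i / s)).+1.
(* Any common bound for the numbers [k i] of cubes along the axes would do; it makes multi-indices
   functions into one type ['I_K]. *)
pose K := (\sum_i k i)%N.
have kK i : (k i <= K)%N by rewrite /K (bigD1 i) //= leq_addr.
have sneq : s != 0 by rewrite gt_eqF.
have ks i : (k i)%:R * s <= a i + s.
  rewrite /k -natr1 mulrDl mul1r lerD2r -ler_pdivlMr //.
  by rewrite truncn_le divr_ge0 // ltW.
pose F := {ffun 'I_n.+1 -> 'I_K}.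
pose Q (j : F) : set V :=
  [set x | forall i, `|x 0 i - (p.1 0 i + s * (j i)%:R)| <= s].
pose P (j : F) := j \in family (fun i => [pred m : 'I_K | (m < k i)%N]).
have sub : phi @` box p `<=` \big[setU/set0]_(j | P j) (phi @` Q j).
  move=> _ [x px <-].
  pose t i := (x 0 i - p.1 0 i) / s.
  have t0 i : 0 <= t i.
    by have /andP[h1 h2] := px i; rewrite divr_ge0 ?subr_ge0 // ltW.
  have tk i : (Num.truncn (t i) < k i)%N.
    rewrite ltnS; apply: le_truncn; rewrite ler_pM2r ?invr_gt0 //.
    have /andP[h1 h2] := px i.
    by rewrite /a le_max lerD2r h2 orbT.
  pose j : F := [ffun i => Ordinal (leq_trans (tk i) (kK i))].
  have Pj : P j by apply/familyP => i; rewrite ffunE; exact: tk.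
  rewrite (bigD1 j) //=; left; exists x => // i; rewrite ffunE /=.
  have xE : x 0 i = p.1 0 i + s * t i by rewrite /t mulrC divfK // addrC subrK.
  have /andP[h1 h2] := truncn_itv (t0 i).
  rewrite xE (_ : _ - _ = s * (t i - (Num.truncn (t i))%:R)); last by ring.
  rewrite normrM gtr0_norm // ger_pMr // ger0_norm ?subr_ge0 //.
  by rewrite lerBlDr addrC natr1 ltW.
apply: le_trans (le_outer_measure outer _ _ sub) _.
apply: le_trans; first exact: lebesgue_outer_bigsetU.
have QC j : (outer (phi @` Q j) <= (((3 * (n.+1%:R * 2)) ^+ n.+1 * s ^+ n.+1)%:E))%E.
  rewrite -exprMn.
  have -> : 3 * (n.+1%:R * 2) * s = 3 * (n.+1%:R * (2 * s)) by ring.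
  apply: lebesgue_outer_diam; first by rewrite !mulr_gt0.
  move=> _ _ [x Qx <-] [y Qy <-] i.
  have -> : phi x 0 i - phi y 0 i = (phi x - phi y) 0 i by rewrite !mxE.
  apply: le_trans (abs_coord_le_enorm _ _) _.
  apply: le_trans (phi1 _ _) _.
  apply: enorm_le => [|m]; first by rewrite mulr_ge0 // ltW.
  have := Qx m; have := Qy m; rewrite !mxE !ler_norml => /andP[? ?] /andP[? ?].
  by apply/andP; split; lra.
apply: le_trans (lee_sum _ (fun j _ => QC j)) _.
rewrite sumEFin lee_fin -big_distrr /= ler_wpM2l ?exprn_ge0 ?mulr_ge0 //.
(* The number of cubes is the product of the [k i]: distributivity turns a product of sums into a
   sum over multi-indices. *)
have -> : \sum_(j : F | P j) s ^+ n.+1 = \prod_i ((k i)%:R * s).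
  rewrite -(eq_bigr _ (fun i _ => @sum_ord_lt K (k i) s (kK i))).
  rewrite bigA_distr_big_dep /=; apply: eq_bigr => j _.
  by rewrite prodr_const card_ord.
by apply: ler_prod => i _; rewrite ks mulr_ge0 // ltW.
Qed.

Lemma lebesgue_outer_nonexpansive (phi : V -> V) (X : set V) :
  (forall x y, enorm (phi x - phi y) <= enorm (x - y)) ->
  (outer (phi @` X) <= ((3 * (n.+1%:R * 2)) ^+ n.+1)%:E * outer X)%E.
Proof.
move=> phi1; apply: lebesgue_outer_image; first by rewrite exprn_gt0 // !mulr_gt0.
by move=> p; exact: lebesgue_outer_nonexpansive_box.
Qed.

End isometries.

(** * Caratheodory measurability of coordinates, norms and reflections *)

Section measurability.
Context (R : realType) (n : nat).
Local Notation V := 'rV[R]_n.+1.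
Local Notation outer := (@lebesgue_outer R n).
Local Notation T := (caratheodory_type outer).

(** The hyperplane cuts each half-open box [p] into two half-open boxes [hi p] and [lo p] whose
    volumes add up, so a cover of [X] splits into covers of its two parts at no cost. *)
Lemma caratheodory_halfspace (i : 'I_n.+1) (a : R) :
  outer.-caratheodory [set x : V | a < x 0 i].
Proof.
apply: le_caratheodory_measurable => X; set H := [set x | _].
apply: le_ereal_inf_tmp => _ [B BX <-].
pose hi (p : V * V) : V * V :=
  (\row_j (if j == i then Num.max (p.1 0 j) a else p.1 0 j), p.2).
pose lo (p : V * V) : V * V :=
  (p.1, \row_j (if j == i then Num.min (p.2 0 j) a else p.2 0 j)).
have vol p : box_volume p = box_volume (hi p) + box_volume (lo p).
  rewrite /box_volume (bigD1 i) //= [X in _ = X + _](bigD1 i) //=.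
  rewrite [X in _ = _ + X](bigD1 i) //= !mxE eqxx.
  have E1 : \prod_(j < n.+1 | j != i) Num.max 0 (p.2 0 j - (hi p).1 0 j) =
            \prod_(j < n.+1 | j != i) Num.max 0 (p.2 0 j - p.1 0 j).
    by apply: eq_bigr => j /negbTE ji; rewrite !mxE ji.
  have E2 : \prod_(j < n.+1 | j != i) Num.max 0 ((lo p).2 0 j - p.1 0 j) =
            \prod_(j < n.+1 | j != i) Num.max 0 (p.2 0 j - p.1 0 j).
    by apply: eq_bigr => j /negbTE ji; rewrite !mxE ji.
  rewrite E1 E2 -mulrDl; congr (_ * _).
  move: (p.1 0 i) (p.2 0 i) => u v; rewrite /Num.max /Num.min.
  by case: (ltP u a) => ?; case: (ltP v a) => ?; do ![case: ltP => ?]; lra.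
apply: (@le_trans _ _ (\sum_(0 <= k <oo) (box_volume (hi (B k)))%:E +
                       \sum_(0 <= k <oo) (box_volume (lo (B k)))%:E)%E).
  apply: leeD; apply: ereal_inf_lbound.
    exists (hi \o B) => // x [/BX [k _ xk] Hx]; exists k => // j.
    have /andP[h1 h2] := xk j; rewrite !mxE h2 andbT.
    by case: eqP => // ->; rewrite gt_max; apply/andP; split; have /andP[] := xk i.
  exists (lo \o B) => // x [/BX [k _ xk] Hx]; exists k => // j.
  have /andP[h1 h2] := xk j; rewrite !mxE h1 /=.
  case: eqP => // ji; rewrite le_min h2 /= ji leNgt; exact/negP.
rewrite -nneseriesD //; try by move=> k _; rewrite lee_fin box_volume_ge0.
by apply: lee_nneseries => k _ *; rewrite -?EFinD lee_fin -?vol ?addr_ge0 ?box_volume_ge0.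
Qed.

Lemma measurable_coord (i : 'I_n.+1) :
  measurable_fun [set: T] (fun x : V => x 0 i).
Proof.
apply: (@measurability _ _ _ _ _ _ (@RGenOInfty.G R)); first exact: RGenOInfty.measurableE.
move=> _ [_ [a ->] <-]; rewrite setTI.
have -> : (fun x : V => x 0 i) @^-1` `]a, +oo[ = [set x : V | a < x 0 i].
  by apply/seteqP; split => x /=; rewrite in_itv /= andbT.
exact: caratheodory_halfspace.
Qed.

Lemma measurable_dotv (v : V) : measurable_fun [set: T] (fun x : V => dotv v x).
Proof.
apply: measurable_sum => i.
by apply: measurable_funM; [exact: measurable_cst|exact: measurable_coord].
Qed.

Lemma measurable_enorm_sub (v : V) :
  measurable_fun [set: T] (fun x : V => enorm (v - x)).
Proof.
have ms : measurable_fun [set: R] (@Num.sqrt R).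
  by apply: nondecreasing_measurable => // x y; exact: ler_wsqrtr.
apply: (measurableT_comp ms); apply: measurable_sum => i.
have mi : measurable_fun [set: T] (fun x : V => (v - x) 0 i).
  under eq_fun do rewrite !mxE.
  by apply: measurable_funB; [exact: measurable_cst|exact: measurable_coord].
exact: measurable_funM.
Qed.

Lemma measurable_enorm : measurable_fun [set: T] (@enorm R n.+1).
Proof.
have := measurable_enorm_sub 0; congr (measurable_fun _ _).
apply/funext => x; congr Num.sqrt; apply: eq_bigr => i _.
by rewrite sub0r !mxE mulrNN.
Qed.

Lemma measurable_enorm_gt (r : R) :
  measurable [set x : T | r < enorm (x : V)].
Proof.
have := measurable_enorm measurableT (measurable_itv `]r, +oo[).
by rewrite setTI; congr measurable; apply/seteqP; split => x /=;
  rewrite in_itv /= andbT.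
Qed.

Lemma measurable_enorm_sub_gt (v : V) (r : R) :
  measurable [set x : T | r < enorm (v - x : V)].
Proof.
have := measurable_enorm_sub v measurableT (measurable_itv `]r, +oo[).
by rewrite setTI; congr measurable; apply/seteqP; split => x /=;
  rewrite in_itv /= andbT.
Qed.

(** The Caratheodory condition involves only the outer measure, which the reflection preserves:
    cutting [X] by the preimage of [A] amounts to cutting the reflected [X] by [A]. *)
Lemma measurable_reflect (v : V) : measurable_fun [set: T] (fun y : T => (v - y : V) : T).
Proof.
move=> _ A mA0; rewrite setTI; have mA : outer.-caratheodory A by exact: mA0.
suff : outer.-caratheodory ((fun y : V => v - y) @^-1` A) by [].
move=> X.
have E (Z : set V) : outer Z = outer ((fun y => v - y) @^-1` Z).
  by rewrite lebesgue_outer_reflect.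
have K (Z W : set V) : (fun y => v - y) @^-1` ((fun y => v - y) @^-1` Z `&` W) =
    Z `&` (fun y => v - y) @^-1` W.
  by apply/seteqP; split => y /=; rewrite subKr.
by rewrite /= E mA; congr (_ + _)%E; rewrite /= E K.
Qed.

End measurability.

(** * Householder reflections exchanging two vectors of equal norm *)

Section householder.
Context (R : realType) (n : nat).
Local Notation V := 'rV[R]_n.+1.

(* For [w = 0] the junk value [0^-1 = 0] makes this the identity, so that
   [householder_swap] needs no case [u = v]. *)
Definition householder (w y : V) : V := y - (2 * dotv w y / dotv w w) *: w.

Lemma dotvBZ (a b : R) (w x y : V) :
  dotv (x - a *: w) (y - b *: w) =
  dotv x y - b * dotv w x - a * dotv w y + a * b * dotv w w.
Proof.
rewrite /dotv !mulr_sumr -!sumrB -big_split /=.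
by apply: eq_bigr => i _; rewrite !mxE; ring.
Qed.

Lemma dotvB (x y z : V) : dotv z (x - y) = dotv z x - dotv z y.
Proof. by rewrite /dotv -sumrB; apply: eq_bigr => i _; rewrite !mxE; ring. Qed.

Lemma dotvZ (a : R) (x z : V) : dotv z (a *: x) = a * dotv z x.
Proof. by rewrite /dotv mulr_sumr; apply: eq_bigr => i _; rewrite !mxE; ring. Qed.

Lemma dotvC (x y : V) : dotv x y = dotv y x.
Proof. by apply: eq_bigr => i _; rewrite mulrC. Qed.

Lemma enormZ (t : R) (x : V) : 0 <= t -> enorm (t *: x) = t * enorm x.
Proof.
move=> t0; rewrite /enorm dotvZ dotvC dotvZ mulrA -expr2 sqrtrM ?sqr_ge0 //.
by rewrite sqrtr_sqr ger0_norm.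
Qed.

Lemma dotvv_eq0 (x : V) : (dotv x x == 0) = (x == 0).
Proof.
apply/eqP/eqP => [x0|->]; last by rewrite /dotv big1 // => i _; rewrite mxE mul0r.
apply/rowP => i; rewrite mxE; apply/eqP; rewrite -normr_le0.
by apply: le_trans (abs_coord_le_enorm _ _) _; rewrite /enorm x0 sqrtr0.
Qed.

Lemma dotv_householder (w x y : V) :
  dotv (householder w x) (householder w y) = dotv x y.
Proof.
rewrite dotvBZ; have [->|w0] := eqVneq (dotv w w) 0; first by rewrite invr0; ring.
by field.
Qed.

Lemma enorm_householder (w y : V) : enorm (householder w y) = enorm y.
Proof. by rewrite /enorm dotv_householder. Qed.

Lemma householderB (w x y : V) :
  householder w (x - y) = householder w x - householder w y.
Proof.
apply/rowP => i; rewrite /householder dotvB !mxE; ring.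
Qed.

Lemma householderK (w : V) : involutive (householder w).
Proof.
move=> y; rewrite {1}/householder.
have [w0|w0] := eqVneq (dotv w w) 0.
  by rewrite w0 invr0 mulr0 scale0r subr0 /householder w0 invr0 mulr0 scale0r subr0.
have -> : dotv w (householder w y) = - dotv w y.
  by rewrite /householder dotvB dotvZ; field.
by rewrite /householder mulrN mulNr scaleNr opprK subrK.
Qed.

(** With [w = u - v], equal norms give [2 * dotv w u = dotv w w], so the coefficient of [w] is 1
    unless [w = 0]. *)
Lemma householder_swap (u v : V) : enorm u = enorm v -> householder (u - v) u = v.
Proof.
move=> uv; rewrite /householder.
have duv : dotv u u = dotv v v by rewrite -!sqr_enorm uv.
have [/eqP|w0] := eqVneq (dotv (u - v) (u - v)) 0.
  by rewrite dotvv_eq0 => /eqP w0; rewrite w0 scaler0 subr0; exact: subr0_eq.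
have E : 2 * dotv (u - v) u = dotv (u - v) (u - v).
  rewrite dotvB !(dotvC (u - v)) !dotvB (dotvC v u) -duv; ring.
by rewrite E divff // scale1r subKr.
Qed.

Lemma enorm_sub_householder (u v y : V) : enorm u = enorm v ->
  enorm (v - householder (u - v) y) = enorm (u - y).
Proof.
by move=> uv; rewrite -{1}(householder_swap uv) -householderB enorm_householder.
Qed.

End householder.

(** * Integrals of functions of the distances to a point and to the origin *)

Section bipolar.
Context (R : realType) (n : nat).
Local Notation V := 'rV[R]_n.+1.
Local Notation outer := (@lebesgue_outer R n).
Local Notation T := (caratheodory_type outer).

(* Integrals are compared after pushing forward to [R * R]: an isometry is not
   known here to preserve Caratheodory measurability. *)
Definition bipolar (u : V) (y : T) : R * R := (enorm (u - y : V), enorm (y : V)).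

Lemma measurable_bipolar (u : V) : measurable_fun [set: T] (bipolar u).
Proof.
by apply: measurable_fun_pair; [exact: measurable_enorm_sub|exact: measurable_enorm].
Qed.

(** The factor lost in [lebesgue_outer_nonexpansive]; what matters is that it depends on the
    dimension alone. *)
Definition isometry_const : R := (3 * (n.+1%:R * 2)) ^+ n.+1.

Lemma isometry_const_ge0 : 0 <= isometry_const.
Proof. by rewrite exprn_ge0 // !mulr_ge0. Qed.

(** The reflection taking [u] to [v] fixes the origin and preserves distances, so it carries one
    preimage of [S] to the other. *)
Lemma lebesgue_outer_bipolar (u v : V) (S : set (R * R)) : enorm u = enorm v ->
  (outer (bipolar u @^-1` S) <= isometry_const%:E * outer (bipolar v @^-1` S))%E.
Proof.
move=> uv; pose phi := householder (u - v).
apply: (@le_trans _ _ (outer (phi @` (bipolar v @^-1` S)))).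
  apply: le_lebesgue_outer => y Sy; exists (phi y); last exact: householderK.
  by rewrite /bipolar /= enorm_sub_householder // enorm_householder.
apply: lebesgue_outer_nonexpansive => x y.
by rewrite -householderB enorm_householder.
Qed.

Local Open Scope ereal_scope.

(** The pushforward of the measure under [bipolar u] is at most [isometry_const] times that under
    [bipolar v], and domination of measures passes to integrals of non-negative functions. *)
Lemma integral_bipolar_le (u v : V) (D : set (R * R)) (h : R * R -> \bar R) :
  enorm u = enorm v -> measurable D -> measurable_fun [set: R * R] h ->
  (forall z, 0 <= h z) ->
  \int[@lebesgueRn R n]_(y in bipolar u @^-1` D) h (bipolar u y) <=
  isometry_const%:E * \int[@lebesgueRn R n]_(y in bipolar v @^-1` D) h (bipolar v y).
Proof.
move=> uv mD mh h0.
have mhD : measurable_fun D h by exact: measurable_funS mh.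
pose mu w := measure_function_pushforward__canonical__measure_function_Measure (@lebesgueRn R n) (measurable_bipolar w).
have E w : \int[@lebesgueRn R n]_(y in bipolar w @^-1` D) h (bipolar w y) =
  \int[mu w]_(z in D) h z.
  by rewrite ge0_integral_pushforward //; exact: measurable_bipolar.
pose C := NngNum isometry_const_ge0.
rewrite !E -(ge0_integral_mscale (mu v) mD C mhD) //.
apply: ge0_le_measure_integral => // S mS.
exact: lebesgue_outer_bipolar.
Qed.

End bipolar.

(** * Eventual bounds, lower limits and tails of integrals *)

Lemma cvge_near_bounds (R : realType) (I : Type) (F : set_system I) {FF : Filter F}
    (u : I -> \bar R) (l e : R) : 0 < e -> u t @[t --> F] --> l%:E ->
  \forall t \near F, ((l - e)%:E <= u t)%E /\ (u t <= (l + e)%:E)%E.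
Proof.
move=> e0 /fine_cvgP [fin /cvgrPdist_le /(_ e e0) near_l].
near=> t; have ft : u t \is a fin_num by near: t.
have : `|l - fine (u t)| <= e by near: t.
by rewrite -(fineK ft) !lee_fin ler_norml => /andP[? ?]; split; lra.
Unshelve. all: by end_near. Qed.

Lemma limn_einf_le (R : realType) (u : (\bar R)^nat) (M : \bar R) :
  (forall k, (u k <= M)%E) -> (limn_einf u <= M)%E.
Proof.
move=> uM; rewrite limn_einf_lim; apply: lime_le; first exact: is_cvg_einfs.
by near=> k; apply: le_trans (uM k); apply: ereal_inf_lbound; exists k => /=.
Unshelve. all: by end_near. Qed.

Section tails.
Context (R : realType) (n : nat).
Local Notation V := 'rV[R]_n.+1.
Local Notation outer := (@lebesgue_outer R n).
Local Notation T := (caratheodory_type outer).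
Local Notation mu := (@lebesgueRn R n).
Local Open Scope ereal_scope.

(** The balls [E k] exhaust the space, so the integrals over them increase to the finite total, and
    the complement of one of them carries at most [e]; a larger [r] only shrinks the tail. *)
Lemma integral_tail_small (F : T -> \bar R) (e : R) :
  measurable_fun [set: T] F -> (forall y, 0 <= F y) ->
  \int[mu]_y F y < +oo -> (0 < e)%R ->
  exists r0 : R, forall r, (r0 <= r)%R ->
    \int[mu]_(y in [set y : V | (r < enorm y)%R]) F y <= e%:E.
Proof.
move=> mF F0 Foo e0.
pose D (r : R) : set T := [set y : V | (r < enorm y)%R].
have mD r : measurable (D r) by exact: measurable_enorm_gt.
pose E (k : nat) : set T := ~` D k%:R.
have mE k : measurable (E k) by exact: measurableC.
have ndE : {homo E : k m / (k <= m)%N >-> (k <= m)%O}.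
  move=> k m km; apply/subsetPset => y Ey Dy; apply: Ey.
  by apply: le_lt_trans Dy; rewrite ler_nat.
have UE : \bigcup_k E k = [set: T].
  apply/seteqP; split => // y _; exists (Num.truncn (enorm (y : V))).+1 => // /lt_trans.
  move=> /(_ _ (truncnS_gt _)); rewrite ltxx //.
have := ge0_nondecreasing_set_cvg_integral (mu := mu) (f := F) ndE mE
  (fun k => measurable_funTS mF) (fun k y _ => F0 y).
rewrite UE -(@fineK _ (\int[mu]_y F y)); last by rewrite ge0_fin_numE // integral_ge0.
move=> /(cvge_near_bounds e0) [k _ /(_ k (leqnn k)) [+ _]].
move=> lb; exists k%:R => r kr.
apply: (@le_trans _ _ (\int[mu]_(y in D k%:R) F y)).
  apply: (ge0_subset_integral mu (mD r) (mD k%:R)) => //; first exact: measurable_funTS.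
  by move=> y; exact: le_lt_trans.
have split_k : \int[mu]_y F y = \int[mu]_(y in E k) F y + \int[mu]_(y in D k%:R) F y.
  rewrite -(setvU (D k%:R)) ge0_integral_setU //; [exact: measurableC|exact: measurable_funTS|].
  by apply/disj_setPS => y [].
have fE : \int[mu]_y F y \is a fin_num by rewrite ge0_fin_numE // integral_ge0.
move: lb; rewrite split_k in fE *.
have : 0 <= \int[mu]_(y in E k) F y by apply: integral_ge0.
have : 0 <= \int[mu]_(y in D k%:R) F y by apply: integral_ge0.
move: fE; case: (\int[mu]_(y in E k) F y) => [a| |] //;
case: (\int[mu]_(y in D k%:R) F y) => [b| |] //= _ _ _.
by rewrite !lee_fin => ?; lra.
Qed.

End tails.

(** * The convolution ratio along the ray spanned by [theta] *)

Section ray.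
Context (R : realType) (n : nat) (f : 'rV[R]_n.+1 -> R).
Local Notation V := 'rV[R]_n.+1.
Local Notation outer := (@lebesgue_outer R n).
Local Notation T := (caratheodory_type outer).
Local Notation mu := (@lebesgueRn R n).
Hypothesis f_ge0 : forall x, 0 <= f x.
Hypothesis mf : measurable_fun [set: T] (f : T -> R).

Definition far (x : V) (r : R) : set T := [set y : V | r < enorm (x - y) /\ r < enorm y].

Lemma measurable_far (x : V) (r : R) : measurable (far x r).
Proof.
by apply: measurableI; [exact: measurable_enorm_sub_gt|exact: measurable_enorm_gt].
Qed.

Definition conv_ratio (x : V) (y : T) : \bar R := (conv_integrand f x y / f x)%:E.

Lemma conv_ratio_ge0 x y : (0 <= conv_ratio x y)%E.
Proof. by rewrite lee_fin divr_ge0 // mulr_ge0. Qed.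

Lemma measurable_conv_ratio x : measurable_fun [set: T] (conv_ratio x).
Proof.
apply/measurable_EFinP; apply: measurable_funM; last exact: measurable_cst.
apply: measurable_funM => //.
exact: (measurableT_comp mf (measurable_reflect x)).
Qed.

Local Open Scope ereal_scope.

Lemma integral_reflect (x : V) (D : set T) (F : T -> \bar R) :
  measurable D -> measurable_fun [set: T] F -> (forall y, 0 <= F y) ->
  \int[mu]_(y in (fun y => (x - y)%R) @^-1` D) F (x - y)%R = \int[mu]_(y in D) F y.
Proof.
move=> mD mF F0.
have E : pushforward mu (fun y : T => (x - y)%R : T) = mu.
  by apply/funext => A; exact: lebesgue_outer_reflect.
rewrite -[in RHS]E ge0_integral_pushforward //; first exact: measurable_reflect.
exact: measurable_funTS.
Qed.

(** The lower bound on [enorm x] makes the balls of radius [r] about 0 and [x] disjoint: at a common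
    point every coordinate of [x] would be at most [2 * r] in absolute value. The piece near [x] is
    replaced by its mirror image, whence the repeated term. *)
Lemma conv_ratio_split (x : V) (r : R) : (0 <= r)%R -> (n.+1%:R * (2 * r) < enorm x)%R ->
  \int[mu]_y conv_ratio x y =
  \int[mu]_(y in ~` [set y : V | (r < enorm y)%R]) conv_ratio x y +
  \int[mu]_(y in ~` [set y : V | (r < enorm y)%R]) conv_ratio x y +
  \int[mu]_(y in far x r) conv_ratio x y.
Proof.
move=> r0 xr; set N := ~` _.
have mN : measurable (N : set T) by apply: measurableC; exact: measurable_enorm_gt.
pose N' : set T := (fun y => (x - y)%R) @^-1` N.
have mN' : measurable N'.
  by have := measurable_reflect x measurableT mN; rewrite setTI.
have mF D := @measurable_funTS _ _ _ _ D _ (measurable_conv_ratio x).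
have NN' : [disjoint N & N'].
  apply/disj_setPS => y [/= /negP + /negP]; rewrite -!leNgt => Ny N'y.
  move: xr; rewrite ltNge => /negP; apply; apply: enorm_le => [|i].
    by rewrite mulr_ge0.
  have := le_trans (abs_coord_le_enorm y i) Ny.
  have := le_trans (abs_coord_le_enorm (x - y) i) N'y.
  by rewrite !mxE !ler_norml => /andP[? ?] /andP[? ?]; apply/andP; split; lra.
have NUE : ~` (N `|` N') = far x r.
  by rewrite setCU /N setCK; apply/seteqP; split => y [/= h1 h2]; split => //;
    move: h2; rewrite /N' /= notK.
have {1}-> : [set: T] = (N `|` N') `|` far x r by rewrite -NUE setUv.
rewrite ge0_integral_setU //; last 4 first.
- exact: measurableU.
- exact: measurable_far.
- by move=> y _; exact: conv_ratio_ge0.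
- by rewrite -NUE; apply/disj_setPS => y [].
congr (_ + _); rewrite ge0_integral_setU //; last by move=> y _; exact: conv_ratio_ge0.
congr (_ + _); rewrite -[RHS](integral_reflect x) //.
- apply: eq_integral => y _; congr ((_ / _)%:E).
  by rewrite /conv_integrand subKr mulrC.
- exact: conv_ratio_ge0.
Qed.

Lemma integral_far_ray_small (theta : V) (gamma A e : R) :
  enorm theta = 1%R ->
  (forall t, (A <= t)%R -> (0 < f (t *: theta))%R) ->
  (forall y : V, (f (t *: theta - y) / f (t *: theta))%R @[t --> +oo%R]
     --> expR (gamma * dotv theta y)%R) ->
  tilted_mass f gamma theta < +oo ->
  conv2 f (t *: theta) * ((f (t *: theta))^-1)%:E @[t --> +oo%R]
    --> 2%:E * tilted_mass f gamma theta ->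
  (0 < e)%R ->
  exists r0 : R, (A <= r0)%R /\ exists t0 : R, forall t, (t0 <= t)%R ->
    \int[mu]_(y in far (t *: theta) r0) conv_ratio (t *: theta) y <= e%:E.
Proof.
move=> theta1 fpos limf mass_fin lim_conv e0.
pose F (y : T) : \bar R := (expR (gamma * dotv theta (y : V)) * f y)%:E.
have mF : measurable_fun [set: T] F.
  apply/measurable_EFinP; apply: measurable_funM; last exact: mf.
  apply: (measurableT_comp (@measurable_expR R)).
  by apply: measurable_funM; [exact: measurable_cst|exact: measurable_dotv].
have F0 y : 0 <= F y by rewrite lee_fin mulr_ge0 // expR_ge0.
(* Budget: if the far piece exceeds [e] while the whole is at most [2 * h + e / 8], the near piece
   is at most [h - 7 * e / 16], hence at most [h - e / 4]. By Fatou this bounds the mass of [F] on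
   the ball, which is at least [h - e / 8]. *)
have e8 : (0 < e / 8)%R by rewrite divr_gt0.
have [r1 tail] := integral_tail_small mF F0 mass_fin e8.
pose r0 := Num.max 0%R (Num.max A r1); exists r0.
have r00 : (0 <= r0)%R by rewrite le_max lexx.
split; first by rewrite /r0 !le_max lexx orbT.
have {tail} := tail r0; rewrite {1}/r0 !le_max lexx !orbT => /(_ isT) tail.
pose D : set T := [set y : V | (r0 < enorm y)%R].
have mD : measurable D by exact: measurable_enorm_gt.
have mass_split : tilted_mass f gamma theta =
    \int[mu]_(y in ~` D) F y + \int[mu]_(y in D) F y.
  rewrite /tilted_mass -[in LHS](setvU D) ge0_integral_setU //.
  - exact: measurableC.
  - exact: measurable_funTS.
  - by move=> y _; exact: F0.
  - by apply/disj_setPS => y [].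
have massE : tilted_mass f gamma theta = (fine (tilted_mass f gamma theta))%:E.
  by rewrite fineK // ge0_fin_numE //; apply: integral_ge0 => y _; exact: F0.
move: massE lim_conv mass_split; set h := fine _ => -> lim_conv mass_split.
rewrite -EFinM in lim_conv.
have [t1 [_ near_conv]] := cvge_near_bounds e8 lim_conv.
(* Fatou's lemma concerns sequences, so a failure for arbitrarily large [t] is first turned into a
   sequence [t k]. *)
apply: contrapT => /forallNP noT.
(* The terms ensure, in order, divergence, the bound on the convolution, positivity of [f] on the
   ray, and disjoint balls; each [+ 1] makes an inequality strict. *)
pose tmin k := Num.max (k%:R) (Num.max (t1 + 1) (Num.max A (n.+1%:R * (2 * r0) + 1)))%R.
have /choice[t tP] k : exists t, (tmin k <= t)%R /\
    e%:E < \int[mu]_(y in far (t *: theta) r0) conv_ratio (t *: theta) y.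
  have /existsNP[t /not_implyP[kt /negP lt_e]] := noT (tmin k).
  by exists t; split => //; rewrite ltNge.
have small_J k : \int[mu]_(y in ~` D) conv_ratio (t k *: theta) y <= (h - e / 4)%:E.
  have [] := tP k; rewrite /tmin !ge_max => /andP[_ /andP[tt1 /andP[tA tr]]] It.
  have tpos : (0 <= t k)%R by apply: le_trans tr; rewrite addr_ge0 // !mulr_ge0.
  have ft := fpos _ tA.
  have /near_conv [_] : (t1 < t k)%R by lra.
  have -> : conv2 f (t k *: theta) * ((f (t k *: theta))^-1)%:E =
      \int[mu]_y conv_ratio (t k *: theta) y.
    rewrite muleC -ge0_integralZl_EFin //.
    - by apply: eq_integral => y _; rewrite -EFinM mulrC.
    - by move=> y _; rewrite lee_fin mulr_ge0.
    - apply/measurable_EFinP; apply: measurable_funM; last exact: mf.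
      exact: (measurableT_comp mf (measurable_reflect _)).
    - by rewrite invr_ge0.
  rewrite (conv_ratio_split r00); last by rewrite enormZ // theta1 mulr1; lra.
  have : 0 <= \int[mu]_(y in ~` D) conv_ratio (t k *: theta) y.
    by apply: integral_ge0 => y _; exact: conv_ratio_ge0.
  move: It; rewrite -/D.
  case: (\int[mu]_(y in far _ _) _) => [a| |] //;
  case: (\int[mu]_(y in ~` D) _) => [b| |] //=.
  by rewrite -!EFinD !lee_fin lte_fin => *; lra.
have t_oo : t k @[k --> \oo] --> +oo%R.
  apply: (@ger_cvgy _ _ _ _ (fun k => k%:R)) => //; last exact: cvgr_idn.
  by apply: nearW => k; have [+ _] := tP k; rewrite ge_max => /andP[].
have limE y : limn_einf (fun k => conv_ratio (t k *: theta) y) = F y.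
  apply: (cvg_limn_einf_sup _).1; apply: cvg_EFin; first exact: nearW.
  rewrite /= /conv_ratio /conv_integrand.
  under eq_fun do rewrite /= mulrAC.
  apply: cvgM; last exact: cvg_cst.
  exact: (cvg_comp _ _ t_oo (limf y)).
have mDc : measurable (~` D) by exact: measurableC.
have := fatou mu mDc (fun k => measurable_funTS (measurable_conv_ratio (t k *: theta)))
  (fun k y _ => conv_ratio_ge0 (t k *: theta) y).
under eq_integral do rewrite limE.
move=> /le_trans /(_ (limn_einf_le small_J)).
have : 0 <= \int[mu]_(y in ~` D) F y by apply: integral_ge0.
have : 0 <= \int[mu]_(y in D) F y by apply: integral_ge0.
move: tail mass_split; rewrite -/D.
case: (\int[mu]_(y in D) F y) => [a| |] //;
case: (\int[mu]_(y in ~` D) F y) => [b| |] //=.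
by rewrite -EFinD !lee_fin => ? [?] *; lra.
Qed.

End ray.

(** * Comparison with the radial profile and smallness of [Kfun] *)

Section comparison.
Context (R : realType) (n : nat) (f : 'rV[R]_n.+1 -> R) (A c : R) (g : R -> R).
Local Notation V := 'rV[R]_n.+1.
Local Notation outer := (@lebesgue_outer R n).
Local Notation T := (caratheodory_type outer).
Local Notation mu := (@lebesgueRn R n).
Hypothesis f_ge0 : forall x, 0 <= f x.
Hypothesis mf : measurable_fun [set: T] (f : T -> R).
Hypothesis f_int : (\int[mu]_y (f y)%:E < +oo)%E.
Hypothesis A1 : 1 <= A.
Hypothesis c1 : 1 <= c.
Hypothesis g_gt0 : forall s, A <= s -> 0 < g s.
Hypothesis g_dec : forall s t, A <= s -> A <= t -> s <= t -> g t <= g s.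
Hypothesis fg : forall x, A <= enorm x ->
  c^-1 * g (enorm x) <= f x /\ f x <= c * g (enorm x).

Let c0 : 0 < c. Proof. exact: lt_le_trans c1. Qed.

Lemma density_gt0 (x : V) : A <= enorm x -> 0 < f x.
Proof.
by move=> Ax; apply: lt_le_trans (fg Ax).1; rewrite mulr_gt0 ?invr_gt0 ?g_gt0.
Qed.

Lemma profile_le_density (x : V) : A <= enorm x -> g (enorm x) <= c * f x.
Proof. by move=> Ax; rewrite -ler_pdivrMl //; exact: (fg Ax).1. Qed.

(** Nothing is known of [g] below [A]; extending it by the constant [g A] makes it monotone on the
    whole line, hence measurable. *)
Let gA (s : R) : R := g (Num.max A s).

Let gA_ge0 s : 0 <= gA s.
Proof. by rewrite ltW // g_gt0 // le_max lexx. Qed.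

Let gAE s : A <= s -> gA s = g s.
Proof. by move=> As; rewrite /gA max_r. Qed.

Let measurable_gA : measurable_fun [set: R] gA.
Proof.
apply: nonincreasing_measurable => // s t st.
by apply: g_dec; rewrite ?ge_max !le_max lexx ?st ?orbT.
Qed.

Let gg (z : R * R) : \bar R := (gA z.1 * gA z.2)%:E.

Let measurable_gg : measurable_fun [set: R * R] gg.
Proof.
apply/measurable_EFinP; apply: measurable_funM.
  exact: (measurableT_comp measurable_gA measurable_fst).
exact: (measurableT_comp measurable_gA measurable_snd).
Qed.

Let gg_ge0 z : (0 <= gg z)%E.
Proof. by rewrite lee_fin mulr_ge0. Qed.

(** By conversion, its preimage under [bipolar x] is [far x r]. *)
Let quadrant (r : R) : set (R * R) := [set z | r < z.1 /\ r < z.2].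

Let measurable_quadrant r : measurable (quadrant r).
Proof.
have -> : quadrant r = `]r, +oo[%classic `*` `]r, +oo[%classic.
  by apply/seteqP; split => -[a b] /=; rewrite !in_itv /= !andbT.
by apply: measurableX; exact: measurable_itv.
Qed.

Local Open Scope ereal_scope.

Let measurable_gg_bipolar (x : V) : measurable_fun [set: T] (fun y => gg (bipolar x y)).
Proof. exact: (measurableT_comp measurable_gg (measurable_bipolar x)). Qed.

(** Replacing the three values of [f] in the ratio by values of [g] costs [c ^+ 3], and returning to
    [f] at [v] costs as much again; [G] cancels since [v] and [x] have equal norms. In between,
    [integral_bipolar_le] moves [x] to [v]. *)
Lemma integral_far_le_radial (x v : V) (r : R) : (A <= r)%R ->
  (A <= enorm x)%R -> enorm v = enorm x ->
  \int[mu]_(y in far x r) conv_ratio f x y <=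
  (c ^+ 6 * isometry_const R n)%:E * \int[mu]_(y in far v r) conv_ratio f v y.
Proof.
move=> Ar Ax vx; set G := g (enorm x); have G0 : (0 < G)%R by exact: g_gt0.
have fx := density_gt0 Ax.
have fv : (0 < f v)%R by apply: density_gt0; rewrite vx.
have up : \int[mu]_(y in far x r) conv_ratio f x y <=
    (c ^+ 3 / G)%:E * \int[mu]_(y in far x r) gg (bipolar x y).
  rewrite -ge0_integralZl_EFin //; last 3 first.
  - exact: measurable_far.
  - exact: measurable_funTS.
  - by rewrite divr_ge0 ?exprn_ge0 // ltW.
  apply: ge0_le_integral.
  - exact: measurable_far.
  - by move=> y _; exact: conv_ratio_ge0.
  - by apply: measurable_funTS; exact: measurable_conv_ratio.
  - by apply: measurable_funeM; exact: measurable_funTS.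
  move=> y [/ltW/(le_trans Ar) Axy /ltW/(le_trans Ar) Ay].
  rewrite -EFinM lee_fin /= !gAE // /conv_integrand.
  rewrite ler_pdivrMr //.
  apply: (@le_trans _ _ (c * g (enorm (x - y)) * (c * g (enorm y)))%R).
    by apply: ler_pM => //; [exact: (fg Axy).2|exact: (fg Ay).2].
  have := profile_le_density Ax; rewrite -/G => Gf.
  have -> : (c ^+ 3 / G * (g (enorm (x - y)) * g (enorm y)) * f x =
    c * g (enorm (x - y)) * (c * g (enorm y)) * (c * f x / G))%R.
    by field; rewrite gt_eqF.
  rewrite ler_peMr ?ler_pdivlMr ?mul1r //.
  by rewrite !mulr_ge0 ?(ltW c0) ?ltW ?g_gt0.
have low : \int[mu]_(y in far v r) gg (bipolar v y) <=
    (c ^+ 3 * G)%:E * \int[mu]_(y in far v r) conv_ratio f v y.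
  rewrite -ge0_integralZl_EFin //; last 4 first.
  - exact: measurable_far.
  - by move=> y _; exact: conv_ratio_ge0.
  - by apply: measurable_funTS; exact: measurable_conv_ratio.
  - by rewrite mulr_ge0 ?exprn_ge0 // ltW.
  apply: ge0_le_integral.
  - exact: measurable_far.
  - by move=> y _; exact: gg_ge0.
  - exact: measurable_funTS.
  - by apply: measurable_funeM; apply: measurable_funTS; exact: measurable_conv_ratio.
  move=> y [/ltW/(le_trans Ar) Axy /ltW/(le_trans Ar) Ay].
  rewrite -EFinM lee_fin /= !gAE // /conv_integrand.
  apply: (@le_trans _ _ (c * f (v - y) * (c * f y))%R).
    by apply: ler_pM; [exact/ltW/g_gt0|exact/ltW/g_gt0|
                       exact: profile_le_density|exact: profile_le_density].
  have fvG : (f v <= c * G)%R by rewrite /G -vx; apply: (fg _).2; rewrite vx.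
  have -> : (c ^+ 3 * G * (f (v - y) * f y / f v) =
    c * f (v - y) * (c * f y) * (c * G / f v))%R.
    by field; rewrite gt_eqF.
  rewrite ler_peMr ?ler_pdivlMr ?mul1r //.
  by rewrite !mulr_ge0 ?(ltW c0).
apply: (le_trans up).
have -> : (c ^+ 6 * isometry_const R n)%:E =
    (c ^+ 3 / G)%:E * ((isometry_const R n)%:E * (c ^+ 3 * G)%:E).
  by rewrite -!EFinM; congr (_%:E); field; rewrite gt_eqF.
rewrite -!muleA; apply: lee_wpmul2l.
  by rewrite lee_fin divr_ge0 ?exprn_ge0 // ltW.
apply: (le_trans (integral_bipolar_le (esym vx) (measurable_quadrant r) measurable_gg gg_ge0)).
by apply: lee_wpmul2l => //; rewrite lee_fin isometry_const_ge0.
Qed.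

(** On the domain [f (x - y)] is at most [c * g A], and [f x] is at least [g t / c]; the remaining
    factor [f y] gives the tail. *)
Lemma integral_far_le_tail (x : V) (t r : R) : (A <= r)%R ->
  (A <= enorm x)%R -> (enorm x <= t)%R ->
  \int[mu]_(y in far x r) conv_ratio f x y <=
  (c ^+ 2 * g A / g t)%:E * \int[mu]_(y in [set y : V | (r < enorm y)%R]) (f y)%:E.
Proof.
move=> Ar Ax xt; have At := le_trans Ax xt.
have [gA0 gt0] : (0 < g A /\ 0 < g t)%R by split; exact: g_gt0.
have fx := density_gt0 Ax.
have K0 : (0 <= c ^+ 2 * g A / g t)%R.
  by rewrite divr_ge0 ?mulr_ge0 ?exprn_ge0 // ltW.
have mfE D : measurable_fun (D : set T) (fun y : T => (f y)%:E).
  by apply: measurable_funTS; exact/measurable_EFinP.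
rewrite -ge0_integralZl_EFin //; last 2 first.
- exact: measurable_enorm_gt.
- by move=> y _; rewrite lee_fin.
apply: (@le_trans _ _ (\int[mu]_(y in far x r) ((c ^+ 2 * g A / g t)%:E * (f y)%:E))).
  apply: ge0_le_integral.
  - exact: measurable_far.
  - by move=> y _; exact: conv_ratio_ge0.
  - by apply: measurable_funTS; exact: measurable_conv_ratio.
  - by apply: measurable_funeM.
  move=> y [/ltW/(le_trans Ar) Axy _].
  rewrite -EFinM lee_fin /= /conv_integrand ler_pdivrMr //.
  rewrite mulrAC; apply: ler_wpM2r => //.
  have h1 : (f (x - y) <= c * g A)%R.
    by apply: le_trans (fg Axy).2 _; rewrite ler_pM2l // g_dec.
  have h2 : (g t <= c * f x)%R.
    by apply: le_trans (profile_le_density Ax); apply: g_dec.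
  apply: (le_trans h1).
  have -> : (c ^+ 2 * g A / g t * f x = c * g A * (c * f x / g t))%R.
    by field; rewrite gt_eqF.
  rewrite ler_peMr ?ler_pdivlMr ?mul1r //.
  by rewrite mulr_ge0 // ltW.
apply: ge0_subset_integral.
- exact: measurable_far.
- exact: measurable_enorm_gt.
- by apply: measurable_funeM.
- by move=> y _; rewrite -EFinM lee_fin mulr_ge0.
- by move=> y [].
Qed.

Lemma Kfun_small (theta : V) (gamma e : R) :
  enorm theta = 1%R ->
  (forall y : V, (f (t *: theta - y) / f (t *: theta))%R @[t --> +oo%R]
     --> expR (gamma * dotv theta y)%R) ->
  tilted_mass f gamma theta < +oo ->
  conv2 f (t *: theta) * ((f (t *: theta))^-1)%:E @[t --> +oo%R]
    --> 2%:E * tilted_mass f gamma theta ->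
  (0 < e)%R -> exists r0 : R, forall r, (r0 <= r)%R -> Kfun f A r <= e%:E.
Proof.
move=> theta1 limf mass_fin lim_conv e0.
have A0 : (0 <= A)%R by exact: le_trans A1.
have normt t : (A <= t)%R -> enorm (t *: theta) = t.
  by move=> At; rewrite enormZ ?theta1 ?mulr1 // (le_trans A0).
have fpos t : (A <= t)%R -> (0 < f (t *: theta))%R.
  by move=> At; apply: density_gt0; rewrite normt.
have K0 : (0 < c ^+ 6 * isometry_const R n)%R.
  by rewrite mulr_gt0 ?exprn_gt0 // !mulr_gt0.
have e1 : (0 < e / (c ^+ 6 * isometry_const R n))%R by rewrite divr_gt0.
have [r0 [Ar0 [t0 ray]]] :=
  integral_far_ray_small f_ge0 mf theta1 fpos limf mass_fin lim_conv e1.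
(* The ray provides [r0] and then [t1]; the tail radius comes last, since the bound for
   [enorm x <= t1] has [g t1] in its denominator. *)
pose t1 := Num.max A t0.
have gt1 : (0 < g t1)%R by rewrite g_gt0 // le_max lexx.
have L0 : (0 < c ^+ 2 * g A / g t1)%R by rewrite divr_gt0 // mulr_gt0 ?exprn_gt0 ?g_gt0.
have e2 : (0 < e / (c ^+ 2 * g A / g t1))%R by rewrite divr_gt0.
have mfE : measurable_fun [set: T] (fun y : T => (f y)%:E) by exact/measurable_EFinP.
have fE0 (y : T) : 0 <= (f y)%:E by rewrite lee_fin.
have [r2 tail] := integral_tail_small mfE fE0 f_int e2.
exists (Num.max r0 r2) => r; rewrite ge_max => /andP[r0r r2r].
apply: ge_ereal_sup => _ [x Ax <-].
have [xt1|t1x] := leP (enorm x) t1.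
  apply: (le_trans (integral_far_le_tail (le_trans Ar0 r0r) Ax xt1)).
  apply: (@le_trans _ _ ((c ^+ 2 * g A / g t1)%:E * (e / (c ^+ 2 * g A / g t1))%:E)).
    by apply: lee_wpmul2l; [rewrite lee_fin ltW|exact: tail].
  by rewrite -EFinM lee_fin mulrC divfK // gt_eqF.
(* As [far x r] shrinks when [r] grows, the fixed radius [r0] serves all larger [r], and [x] is
   compared with the point of the ray of the same norm. *)
apply: (@le_trans _ _ (\int[mu]_(y in far x r0) conv_ratio f x y)).
  apply: (ge0_subset_integral mu (measurable_far x r) (measurable_far x r0)).
  - by apply: measurable_funTS; exact: measurable_conv_ratio.
  - by move=> y _; exact: conv_ratio_ge0.
  - by move=> y [h1 h2]; split; exact: le_lt_trans r0r _.
apply: (le_trans (integral_far_le_radial Ar0 Ax (normt _ Ax))).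
apply: (@le_trans _ _ ((c ^+ 6 * isometry_const R n)%:E *
                       (e / (c ^+ 6 * isometry_const R n))%:E)).
  apply: lee_wpmul2l; first by rewrite lee_fin ltW.
  by apply: ray; move: t1x; rewrite gt_max => /andP[_ /ltW].
by rewrite -EFinM lee_fin mulrC divfK // gt_eqF.
Qed.

End comparison.

(** * Passage to the limit and conclusion *)

Lemma cvge0_squeeze (R : realType) (K : R -> \bar R) :
  (forall r, (0 <= K r)%E) ->
  (forall e, 0 < e -> exists r0, forall r, r0 <= r -> (K r <= e%:E)%E) ->
  K r @[r --> +oo] --> 0%E.
Proof.
move=> K0 Ksmall; apply/fine_cvgP; split.
  have [r0 Kr0] := Ksmall 1 ltr01.
  near=> r; rewrite ge0_fin_numE //.
  by apply: le_lt_trans (Kr0 _ _) (ltry _); near: r; apply: nbhs_pinfty_ge; rewrite num_real.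
apply/cvgrPdist_le => e /Ksmall[r0 Kr0].
near=> r; have /Kr0 : r0 <= r by near: r; apply: nbhs_pinfty_ge; rewrite num_real.
rewrite sub0r normrN /=; have := K0 r.
by case: (K r) => [x| |] //=; rewrite !lee_fin => x0 xe; rewrite ger0_norm.
Unshelve. all: by end_near. Qed.

Unset Implicit Arguments.

Theorem theorem1p3 (R : realType) (n : nat) (f : 'rV[R]_n.+1 -> R)
    (theta : 'rV[R]_n.+1) (gamma : R)
    (f_density : density f)
    (theta_sphere : enorm theta = 1)
    (gamma_ge0 : 0 <= gamma)
    (cond_i : forall y : 'rV[R]_n.+1,
       f (t *: theta - y) / f (t *: theta) @[t --> +oo]
         --> expR (gamma * dotv theta y))
    (cond_ii_fin : (tilted_mass f gamma theta < +oo)%E)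
    (cond_ii_lim :
       (conv2 f (t *: theta) * ((f (t *: theta))^-1)%:E)%E @[t --> +oo]
         --> (2%:E * tilted_mass f gamma theta)%E) :
  (forall (A : R) (g : R -> R),
     1 <= A ->
     pos_decreasing [set s | A <= s] g ->
     asymp [set x | A <= enorm x] f (fun x => g (enorm x)) ->
     Kfun f A r @[r --> +oo] --> 0%E) /\
  (almost_radial_decreasing f -> Kfun f 1 r @[r --> +oo] --> 0%E).
Proof.
case: f_density => f_ge0 _ f_int.
have mf : measurable_fun [set: caratheodory_type (@lebesgue_outer R n)] f.
  by apply/measurable_EFinP; exact: measurable_int f_int.
have int_lt : (\int[lebesgueRn]_y (f y)%:E < +oo)%E.
  have /integrableP[_] := f_int.
  by under eq_integral do rewrite /= ger0_norm //.
have main (A : R) (g : R -> R) : 1 <= A -> pos_decreasing [set s | A <= s] g ->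
    asymp [set x | A <= enorm x] f (fun x => g (enorm x)) ->
    Kfun f A r @[r --> +oo] --> 0%E.
  move=> A1 [g0 g_dec] [c c1 fg]; apply: cvge0_squeeze => [r|e e0].
    apply: le_ereal_sup_tmp.
    (* An empty supremum would be [-oo]; the point [A *: theta], of norm [A], supplies a
       non-negative member. *)
    exists (\int[lebesgueRn]_(y in far (A *: theta) r) conv_ratio f (A *: theta) y)%E.
      by exists (A *: theta) => //=; rewrite enormZ ?theta_sphere ?mulr1 // (le_trans _ A1).
    by apply: integral_ge0 => y _; exact: conv_ratio_ge0.
  exact: (Kfun_small f_ge0 mf int_lt A1 c1 g0 g_dec fg theta_sphere cond_i
    cond_ii_fin cond_ii_lim e0).
split=> // -[_ [g [g0 g_dec] [c c1 fg]]].
apply: (main 1 g) => //.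
  split=> [s s1|s t s1 t1]; first by apply: g0; exact: lt_le_trans ltr01 s1.
  by apply: g_dec; [exact: lt_le_trans ltr01 s1|exact: lt_le_trans ltr01 t1].
exists c => // x x1; apply: fg; apply/eqP => x0; move: x1.
by rewrite /= x0 /enorm /dotv big1 ?sqrtr0 ?ler10 // => i _; rewrite mxE mul0r.
Qed.
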